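(* If $f\in\mathcal{S}^*_{\mathfrak{B}}$, then $f\in\mathcal{S}^*_e$, where $\mathcal{S}^*_e=\{f\in\mathcal{A}: zf'(z)/f(z)\prec e^z\}$.
   Context: $\mathbb{D}$ is the open unit disk. $\mathcal{A}$ is the class of analytic functions $f$ in $\mathbb{D}$ with $f(z)=z+\sum_{n\ge2}a_nz^n$, and $\mathcal{S}\subset\mathcal{A}$ is the subclass of univalent functions. $f\prec g$ (subordination) means $f=g\circ w$ for some analytic $w:\mathbb{D}\to\mathbb{D}$ with $w(0)=0$. $\mathfrak{B}(z)=\sqrt{1+\tanh z}$ (principal branch), and $\mathcal{S}^*_{\mathfrak{B}}=\{f\in\mathcal{S}: zf'(z)/f(z)\prec\mathfrak{B}(z)\}$. *)

(* Defs.v *)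
From Stdlib Require Import Reals Lra.
From Coquelicot Require Import Coquelicot.

Open Scope R_scope.

Definition in_disk (z : C) : Prop := Cmod z < 1.

Definition analytic_on_disk (f : C -> C) : Prop :=
  forall z : C, in_disk z -> @ex_derive C_AbsRing C_NormedModule f z.

Definition univalent_on_disk (f : C -> C) : Prop :=
  forall z1 z2 : C, in_disk z1 -> in_disk z2 -> f z1 = f z2 -> z1 = z2.

Definition class_A (f : C -> C) : Prop :=
  analytic_on_disk f /\
  exists a : nat -> C,
    a 0%nat = 0%C /\ a 1%nat = 1%C /\
    forall z : C, in_disk z -> @is_pseries C_AbsRing C_NormedModule a z (f z).

Definition class_S (f : C -> C) : Prop := class_A f /\ univalent_on_disk f.

Definition subordinate (f g : C -> C) : Prop :=
  exists w : C -> C,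
    analytic_on_disk w /\
    (forall z : C, in_disk z -> in_disk (w z)) /\
    w 0%C = 0%C /\
    forall z : C, in_disk z -> f z = g (w z).

Definition Cexp (z : C) : C := (exp (Re z) * cos (Im z), exp (Re z) * sin (Im z)).

Definition Ctanh (z : C) : C :=
  ((Cexp z - Cexp (- z)) / (Cexp z + Cexp (- z)))%C.

(* Principal branch: the root with argument in (-pi/2, pi/2]
   (see [Csqrt_sqr] and [Csqrt_principal]). *)
Definition Csqrt (z : C) : C :=
  (sqrt ((Cmod z + Re z) / 2),
   if Rle_dec 0 (Im z) then sqrt ((Cmod z - Re z) / 2)
   else - sqrt ((Cmod z - Re z) / 2)).

Lemma Csqrt_sqr (z : C) : (Csqrt z * Csqrt z)%C = z.
Proof.
destruct z as [x y].
assert (Hm : 0 <= Cmod (x, y)) by apply Cmod_ge_0.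
assert (Hs : Cmod (x, y) * Cmod (x, y) = x * x + y * y).
{ unfold Cmod; simpl; rewrite sqrt_sqrt; nra. }
unfold Csqrt, Cmult; simpl.
set (m := Cmod (x, y)) in *.
assert (Hp : 0 <= (m + x) / 2) by nra.
assert (Hn : 0 <= (m - x) / 2) by nra.
assert (E : sqrt ((m + x) / 2) * sqrt ((m - x) / 2) = Rabs y / 2).
{ rewrite <- sqrt_mult by assumption.
  replace ((m + x) / 2 * ((m - x) / 2)) with (Rsqr (y / 2)) by (unfold Rsqr; nra).
  rewrite sqrt_Rsqr_abs; unfold Rdiv; rewrite Rabs_mult.
  rewrite (Rabs_right (/ 2)); lra. }
pose proof (sqrt_sqrt _ Hp) as Ep.
pose proof (sqrt_sqrt _ Hn) as En.
destruct (Rle_dec 0 y) as [Hy | Hy].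
- rewrite Rabs_right in E by lra. f_equal; nra.
- rewrite Rabs_left in E by lra. f_equal; nra.
Qed.

Lemma Csqrt_principal (z : C) :
  0 < Re (Csqrt z) \/ (Re (Csqrt z) = 0 /\ 0 <= Im (Csqrt z)).
Proof.
destruct z as [x y].
assert (Hm : 0 <= Cmod (x, y)) by apply Cmod_ge_0.
assert (Hs : Cmod (x, y) * Cmod (x, y) = x * x + y * y).
{ unfold Cmod; simpl; rewrite sqrt_sqrt; nra. }
unfold Csqrt; simpl.
set (m := Cmod (x, y)) in *.
destruct (Rle_dec 0 y) as [Hy | Hy].
- destruct (sqrt_pos ((m + x) / 2)) as [H | H]; [now left | right].
  split; [now symmetry | apply sqrt_pos].
- left; apply sqrt_lt_R0; nra.
Qed.

Definition frakB (z : C) : C := Csqrt (1 + Ctanh z)%C.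

(* z f'(z) / f(z), with its removable singularity at 0 filled in: its limit
   there is 1 for f in [class_A].  Elsewhere, division by zero gives 0, which is
   not a value of [Cexp] or of [frakB] on the disk, so subordination to either
   of these forces f(z) <> 0 for 0 < |z| < 1. *)
Definition zdlog (f : C -> C) (z : C) : C :=
  if Ceq_dec z 0%C then 1%C else (z * C_derive f z / f z)%C.

Definition S_star_B (f : C -> C) : Prop :=
  class_S f /\ subordinate (zdlog f) frakB.

Definition S_star_e (f : C -> C) : Prop :=
  class_A f /\ subordinate (zdlog f) Cexp.

(* Main.v *)
(* Since [1 + tanh z = 2 / (1 + e^(-2z))], the function
   [logB z = - log ((1 + e^(-2z)) / 2) / 2] satisfies [exp (logB z) = frakB z], so
   if [w] is a Schwarz function for [frakB], then [logB o w] is one for [exp],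
   once [logB] maps the disk into itself.  Put [z = x + iy] and let [L + iA] be
   the logarithm of [(1 + e^(2z)) / 2]: always [|A| <= min (2|y|, pi/2)], and
   either [0 <= L <= 2|x|] or [-1 <= L <= 0], so that [L^2 + A^2 < 4]. *)
Require Import Defs.
From Stdlib Require Import Reals Lra.
From Coquelicot Require Import Coquelicot.

(** * Differentials in two real variables and complex differentiability *)

Lemma differentiable_pt_lim_plus2 (x y : R) : differentiable_pt_lim Rplus x y 1 1.
Proof.
intros eps; exists eps; intros u v _ _.
replace (u + v - (x + y) - (1 * (u - x) + 1 * (v - y))) with 0 by ring.
rewrite Rabs_R0; apply Rmult_le_pos; [apply Rlt_le, cond_pos |].
apply Rle_trans with (2 := Rmax_l _ _), Rabs_pos.
Qed.

Lemma differentiable_pt_lim_mult2 (x y : R) : differentiable_pt_lim Rmult x y y x.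
Proof.
intros eps; exists eps; intros u v Hu _.
replace (u * v - x * y - (y * (u - x) + x * (v - y)))
  with ((u - x) * (v - y)) by ring.
rewrite Rabs_mult; apply Rmult_le_compat; try apply Rabs_pos.
- now apply Rlt_le.
- apply Rmax_r.
Qed.

Lemma differentiable_pt_lim_comp1 (g : R -> R) (f : R -> R -> R) (x y l lx ly : R) :
  is_derive g (f x y) l -> differentiable_pt_lim f x y lx ly ->
  differentiable_pt_lim (fun u v => g (f u v)) x y (l * lx) (l * ly).
Proof.
intros Hg Hf.
(* The zero terms come from regarding [g] as a function of two variables that ignores the second
   one. *)
replace (l * lx) with (l * lx + 0 * lx) by ring.
replace (l * ly) with (l * ly + 0 * ly) by ring.
apply (differentiable_pt_lim_comp (fun u _ => g u) f f); trivial.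
now apply differentiable_pt_lim_proj1_0, is_derive_Reals.
Qed.

Lemma differentiable_pt_lim_mult (f g : R -> R -> R) (x y fx fy gx gy : R) :
  differentiable_pt_lim f x y fx fy -> differentiable_pt_lim g x y gx gy ->
  differentiable_pt_lim (fun u v => f u v * g u v) x y
    (g x y * fx + f x y * gx) (g x y * fy + f x y * gy).
Proof.
intros Hf Hg.
exact (differentiable_pt_lim_comp Rmult f g _ _ _ _ _ _ _ _
         (differentiable_pt_lim_mult2 _ _) Hf Hg).
Qed.

Lemma differentiable_pt_lim_plus (f g : R -> R -> R) (x y fx fy gx gy : R) :
  differentiable_pt_lim f x y fx fy -> differentiable_pt_lim g x y gx gy ->
  differentiable_pt_lim (fun u v => f u v + g u v) x y
    (1 * fx + 1 * gx) (1 * fy + 1 * gy).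
Proof.
intros Hf Hg.
exact (differentiable_pt_lim_comp Rplus f g _ _ _ _ _ _ _ _
         (differentiable_pt_lim_plus2 _ _) Hf Hg).
Qed.

Lemma differentiable_pt_lim_fst (x y : R) :
  differentiable_pt_lim (fun u _ => u) x y 1 0.
Proof.
apply (differentiable_pt_lim_proj1_0 (fun u => u)), derivable_pt_lim_id.
Qed.

Lemma differentiable_pt_lim_snd (x y : R) :
  differentiable_pt_lim (fun _ v => v) x y 0 1.
Proof.
intros eps; exists eps; intros u v _ _.
replace (v - y - (0 * (u - x) + 1 * (v - y))) with 0 by ring.
rewrite Rabs_R0; apply Rmult_le_pos; [apply Rlt_le, cond_pos |].
apply Rle_trans with (2 := Rmax_l _ _), Rabs_pos.
Qed.

(** Multiplication by a + ib is the real linear map with rows (a, -b) and (b, a), so the complex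
    remainder has the real remainders of [u] and [v] as its components. *)
Lemma Cauchy_Riemann_is_derive (u v : R -> R -> R) (z : C) (a b : R) :
  differentiable_pt_lim u (Re z) (Im z) a (- b) ->
  differentiable_pt_lim v (Re z) (Im z) b a ->
  @is_derive C_AbsRing C_NormedModule
    (fun t : C => (u (Re t) (Im t), v (Re t) (Im t))) z (a, b).
Proof.
destruct z as [x y]; simpl; intros Hu Hv; split.
- apply (@is_linear_scal_l C_AbsRing C_NormedModule).
- intros z' Hz'.
  apply (@is_filter_lim_locally_unique C_AbsRing (AbsRing_NormedModule C_AbsRing))
    in Hz'; subst z'.
  intros eps.
  (* Passing from the larger component to the modulus costs a factor sqrt 2 <= 2, which half of
     [eps] absorbs. *)
  destruct (Hu (pos_div_2 eps)) as [d1 H1].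
  destruct (Hv (pos_div_2 eps)) as [d2 H2].
  exists (mkposreal _ (Rmin_stable_in_posreal d1 d2)).
  intros [s t] Hst.
  assert (Hc : Cmod (s - x, t - y) < Rmin d1 d2) by exact Hst.
  pose proof (Rmax_Cmod (s - x, t - y)) as HM; simpl in HM.
  pose proof (Rmax_l (Rabs (s - x)) (Rabs (t - y))).
  pose proof (Rmax_r (Rabs (s - x)) (Rabs (t - y))).
  pose proof (Rmin_l d1 d2); pose proof (Rmin_r d1 d2).
  specialize (H1 s t ltac:(lra) ltac:(lra)).
  specialize (H2 s t ltac:(lra) ltac:(lra)).
  change (Cmod (((u s t, v s t) - (u x y, v x y)) - ((s, t) - (x, y)) * (a, b))%C
          <= eps * Cmod (s - x, t - y)).
  eapply Rle_trans; [apply Cmod_2Rmax |].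
  apply Rle_trans with (2 * (eps / 2 * Rmax (Rabs (s - x)) (Rabs (t - y)))).
  + apply Rmult_le_compat.
    * apply sqrt_pos.
    * apply Rle_trans with (2 := Rmax_l _ _), Rabs_pos.
    * rewrite <- (sqrt_Rsqr 2) at 2 by lra.
      apply sqrt_le_1_alt; unfold Rsqr; lra.
    * apply Rmax_lub; cbn -[pos_div_2].
      -- eapply Rle_trans; [right | exact H1]; f_equal; ring.
      -- eapply Rle_trans; [right | exact H2]; f_equal; ring.
  + pose proof (cond_pos eps); nra.
Qed.

(* Coquelicot has two convertible normed-module structures on [C]; the chain rule
   needs the inner function to use the one induced by [C_AbsRing]. *)
Lemma ex_derive_C_comp (f g : C -> C) (z : C) :
  @ex_derive C_AbsRing C_NormedModule f (g z) ->
  @ex_derive C_AbsRing C_NormedModule g z ->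
  @ex_derive C_AbsRing C_NormedModule (fun t => f (g t)) z.
Proof.
intros Hf [l [[H1 H2 H3] H]].
apply (ex_derive_comp (K := C_AbsRing) (V := C_NormedModule) f g); trivial.
exists l; split; [split; assumption | exact H].
Qed.

Lemma ex_derive_C_affine (c d z : C) :
  @ex_derive C_AbsRing C_NormedModule (fun t => c * t + d)%C z.
Proof.
apply (ex_derive_plus (K := C_AbsRing) (V := C_NormedModule) (fun t => c * t)%C
  (fun _ => d)); [| apply (ex_derive_const (K := C_AbsRing) (V := C_NormedModule))].
apply (ex_derive_ext (K := C_AbsRing) (V := C_NormedModule) (fun t => t * c)%C);
  [intros t; apply Cmult_comm |].
exists c; apply (filterdiff_linear (K := C_AbsRing)
  (U := AbsRing_NormedModule C_AbsRing) (V := C_NormedModule)).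
apply (@is_linear_scal_l C_AbsRing C_NormedModule).
Qed.

Lemma differentiable_pt_lim_cast (f : R -> R -> R) (x y a b a' b' : R) :
  differentiable_pt_lim f x y a b -> a = a' -> b = b' ->
  differentiable_pt_lim f x y a' b'.
Proof. now intros H <- <-. Qed.

(** * Complex exponential, logarithm and square root *)

Lemma is_derive_Cexp (z : C) : @is_derive C_AbsRing C_NormedModule Cexp z (Cexp z).
Proof.
assert (He : is_derive exp (Re z) (exp (Re z))) by (auto_derive; [trivial | ring]).
assert (Hc : is_derive cos (Im z) (- sin (Im z))) by (auto_derive; [trivial | ring]).
assert (Hs : is_derive sin (Im z) (cos (Im z))) by (auto_derive; [trivial | ring]).
apply (Cauchy_Riemann_is_derive
  (fun x y => exp x * cos y) (fun x y => exp x * sin y)).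
- eapply differentiable_pt_lim_cast.
  + apply differentiable_pt_lim_mult.
    * apply (differentiable_pt_lim_comp1 exp (fun x _ => x));
        [exact He | apply differentiable_pt_lim_fst].
    * apply (differentiable_pt_lim_comp1 cos (fun _ y => y));
        [exact Hc | apply differentiable_pt_lim_snd].
  + cbv beta; ring.
  + cbv beta; ring.
- eapply differentiable_pt_lim_cast.
  + apply differentiable_pt_lim_mult.
    * apply (differentiable_pt_lim_comp1 exp (fun x _ => x));
        [exact He | apply differentiable_pt_lim_fst].
    * apply (differentiable_pt_lim_comp1 sin (fun _ y => y));
        [exact Hs | apply differentiable_pt_lim_snd].
  + cbv beta; ring.
  + cbv beta; ring.
Qed.

(* Principal branch, correct on the right half-plane [0 < Re z] only. *)
Definition Clog (z : C) : C :=
  (ln (Re z * Re z + Im z * Im z) / 2, atan (Im z * / Re z)).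

Lemma is_derive_Clog (z : C) : 0 < Re z ->
  @is_derive C_AbsRing C_NormedModule Clog z (/ z)%C.
Proof.
intros Hz.
set (n := Re z * Re z + Im z * Im z).
assert (Hn : 0 < n) by (unfold n; nra).
replace (/ z)%C with (Re z / n, - Im z / n)
  by (unfold Cinv, n in *; clear n; destruct z as [x y]; simpl in *; f_equal; field; lra).
apply (Cauchy_Riemann_is_derive
  (fun x y => ln (x * x + y * y) / 2) (fun x y => atan (y * / x))).
- eapply differentiable_pt_lim_cast.
  + apply (differentiable_pt_lim_comp1 (fun t => ln t / 2)
             (fun x y => x * x + y * y) _ _ (/ (2 * n))).
    * auto_derive; [exact Hn | fold n; field; lra].
    * apply differentiable_pt_lim_plus; apply differentiable_pt_lim_mult.
      -- apply differentiable_pt_lim_fst.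
      -- apply differentiable_pt_lim_fst.
      -- apply differentiable_pt_lim_snd.
      -- apply differentiable_pt_lim_snd.
  + cbv beta; fold n; field; lra.
  + cbv beta; fold n; field; lra.
- eapply differentiable_pt_lim_cast.
  + apply (differentiable_pt_lim_comp1 atan (fun x y => y * / x) _ _
             (Re z * Re z / n)).
    * apply is_derive_Reals.
      replace (Re z * Re z / n) with (/ (1 + (Im z * / Re z) ^ 2))
        by (unfold n; field; split; [fold n|]; lra).
      apply derivable_pt_lim_atan.
    * apply differentiable_pt_lim_mult; [apply differentiable_pt_lim_snd |].
      apply (differentiable_pt_lim_comp1 Rinv (fun x _ => x) _ _
               (- / (Re z * Re z))); [| apply differentiable_pt_lim_fst].
      auto_derive; [lra | field; lra].
  + cbv beta; fold n; field; lra.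
  + cbv beta; fold n; field; lra.
Qed.

(** With s = y/x and x > 0, the modulus is x sqrt(1 + s^2), which cancels the denominator sqrt(1 +
    s^2) of [cos (atan s)] and [sin (atan s)]. *)
Lemma Cexp_Clog (z : C) : 0 < Re z -> Cexp (Clog z) = z.
Proof.
destruct z as [x y]; simpl; intros Hx.
assert (Hn : 0 < x * x + y * y) by nra.
assert (Hs : sqrt (x * x + y * y) = x * sqrt (1 + (y * / x)²)).
{ rewrite <- (sqrt_Rsqr x) at 3 by lra.
  rewrite <- sqrt_mult by (unfold Rsqr; nra).
  f_equal; unfold Rsqr; field; lra. }
unfold Cexp, Clog; simpl.
replace (exp (ln (x * x + y * y) / 2)) with (sqrt (x * x + y * y))
  by (rewrite <- Rpower_sqrt by exact Hn; unfold Rpower; f_equal; field).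
rewrite cos_atan, sin_atan, Hs.
assert (0 < sqrt (1 + (y * / x)²)) by (apply sqrt_lt_R0; unfold Rsqr; nra).
f_equal; field; lra.
Qed.

Lemma Cexp_plus (z w : C) : Cexp (z + w) = (Cexp z * Cexp w)%C.
Proof.
unfold Cexp, Cmult; simpl.
rewrite exp_plus, cos_plus, sin_plus; unfold Re, Im; f_equal; ring.
Qed.

Lemma Cexp_neq_0 (z : C) : Cexp z <> 0%C.
Proof.
intros H; unfold Cexp in H; injection H; intros H2 H1.
pose proof (exp_pos (Re z)); pose proof (sin2_cos2 (Im z)) as H3; unfold Rsqr in H3.
assert (cos (Im z) = 0) by nra; assert (sin (Im z) = 0) by nra; nra.
Qed.

Lemma Cexp_0 : Cexp 0 = 1%C.
Proof. unfold Cexp, RtoC; simpl; rewrite exp_0, cos_0, sin_0; f_equal; ring. Qed.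

Lemma Cexp_opp (z : C) : Cexp (- z) = (/ Cexp z)%C.
Proof.
assert (H : (Cexp z * Cexp (- z) = 1)%C)
  by (rewrite <- Cexp_plus, Cplus_opp_r; apply Cexp_0).
replace (Cexp (- z)) with (/ Cexp z * (Cexp z * Cexp (- z)))%C
  by (field; apply Cexp_neq_0).
rewrite H; ring.
Qed.

(** Two roots of [b] agree up to sign, and the opposite sign would give the principal root a
    negative real part. *)
Lemma Csqrt_unique (a b : C) : 0 < Re a -> (a * a)%C = b -> a = Csqrt b.
Proof.
intros Ha Hb.
pose proof (Csqrt_sqr b) as Hs; pose proof (Csqrt_principal b) as Hp.
set (s := Csqrt b) in *; clearbody s.
assert (H : ((a - s) * (a + s))%C = 0%C)
  by (transitivity (a * a - s * s)%C; [ring | rewrite Hs, Hb; ring]).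
destruct (Ceq_dec (a - s) 0%C) as [H0 | H0].
- transitivity (a - s + s)%C; [ring | rewrite H0; ring].
- exfalso.
  assert (H1 : (a + s = 0)%C).
  { transitivity (/ (a - s) * ((a - s) * (a + s)))%C;
      [now field | rewrite H; ring]. }
  apply (f_equal fst) in H1; simpl in H1.
  destruct Hp as [H2 | [H2 _]]; unfold Re in *; simpl in *; lra.
Qed.

(** * Real inequalities on the unit disk *)

(** A negative cosine forces t > pi/2, and then -cos t = sin (t - pi/2) < t - pi/2 < t - 3/2. *)
Lemma neg_cos_lt (t : R) : 0 <= t -> cos t < 0 -> - cos t < t - 3 / 2.
Proof.
intros Ht Hc; pose proof PI2_3_2.
assert (Hlt : PI / 2 < t).
{ apply Rnot_le_lt; intros Hle.
  pose proof (cos_ge_0 t ltac:(lra) ltac:(lra)); lra. }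
pose proof (sin_lt_x (t - PI / 2) ltac:(lra)) as Hs.
replace (sin (t - PI / 2)) with (- cos t) in Hs
  by (rewrite sin_minus, cos_PI2, sin_PI2; ring).
lra.
Qed.

Lemma cos_Rabs (t : R) : cos (Rabs t) = cos t.
Proof. unfold Rabs; destruct (Rcase_abs t); [apply cos_neg | reflexivity]. Qed.

(** Multiplied by e^(-2x), this makes the real part of 1 + e^(-2z) positive, as [Clog] requires.
    When the cosine is negative, [neg_cos_lt] and e^x >= 1 + x reduce it to 2|y| - 3/2 <= (1 +
    x)^2. *)
Lemma cos_gt_disk (x y : R) : x * x + y * y < 1 -> - exp (2 * x) < cos (2 * y).
Proof.
intros Hxy; pose proof (exp_pos (2 * x)).
destruct (Rle_dec 0 (cos (2 * y))) as [H0 | H0]; [lra |].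
pose proof (neg_cos_lt (Rabs (2 * y)) (Rabs_pos _)) as Hc.
rewrite cos_Rabs, Rabs_mult, (Rabs_pos_eq 2) in Hc by lra.
assert (He : (1 + x) * (1 + x) <= exp (2 * x)).
{ replace (2 * x) with (x + x) by ring; rewrite exp_plus.
  pose proof (exp_ineq1_le x); assert (-1 < x) by nra.
  apply Rmult_le_compat; lra. }
assert (Hy : Rabs y * Rabs y = y * y) by (rewrite <- Rabs_mult; apply Rabs_pos_eq; nra).
(* The constants are near the maximum of [2 y - (1 + x)^2] on the unit circle,
   which is about 1.484. *)
pose proof (Rle_0_sqr (Rabs y - 9 / 10)); pose proof (Rle_0_sqr (x + 9 / 19)).
unfold Rsqr in *; lra.
Qed.

(** The Taylor polynomial 1 - t^2/2 + t^4/24 bounds cos t from above and is negative at 17/10. The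
    constant is chosen below sqrt 3, so that 1 + (pi/2)^2 < 4. *)
Lemma PI2_lt : PI / 2 < 17 / 10.
Proof.
apply Rnot_le_lt; intros H.
pose proof (cos_ge_0 (17 / 10) ltac:(lra) ltac:(lra)) as H0.
pose proof (pre_cos_bound (17 / 10) 0 ltac:(lra) ltac:(lra)) as [_ H1].
unfold cos_approx, cos_term in H1; simpl in H1; lra.
Qed.

(** From e^(1/4) >= 5/4, the eighth power gives e^2 > 16/3. The value 3/16 is the lower bound for
    [N] in [ln_atan_disk]. *)
Lemma exp_opp_2_lt : exp (- 2) < 3 / 16.
Proof.
pose proof (exp_ineq1_le (1 / 4)) as H.
assert (H1 : exp 2 = (exp (1 / 4) * exp (1 / 4) * (exp (1 / 4) * exp (1 / 4)))
  * (exp (1 / 4) * exp (1 / 4) * (exp (1 / 4) * exp (1 / 4))))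
  by (rewrite <- !exp_plus; f_equal; field).
set (e := exp (1 / 4)) in *.
assert (H2 : 25 / 16 <= e * e) by nra.
assert (H3 : 625 / 256 <= e * e * (e * e)) by nra.
assert (H4 : 16 / 3 < exp 2) by (rewrite H1; nra).
change (-2) with (- (2)); rewrite exp_Ropp; apply Rinv_lt_contravar in H4; [| lra].
now replace (3 / 16) with (/ (16 / 3)) by field.
Qed.

Lemma exp_le (x y : R) : x <= y -> exp x <= exp y.
Proof. intros [H | ->]; [now apply Rlt_le, exp_increasing | apply Rle_refl]. Qed.

Lemma atan_le (x y : R) : x <= y -> atan x <= atan y.
Proof. intros [H | ->]; [now apply Rlt_le, atan_increasing | apply Rle_refl]. Qed.

(* The left-hand side is the argument of [1 + r e^(i t)]. *)
Lemma Rabs_atan_arg_le (r t : R) : 0 < r -> Rabs t < PI -> 0 < 1 + r * cos t ->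
  Rabs (atan (r * sin t / (1 + r * cos t))) <= Rabs t.
Proof.
intros Hr.
assert (Hpos : forall t, 0 <= t -> t < PI -> 0 < 1 + r * cos t ->
  Rabs (atan (r * sin t / (1 + r * cos t))) <= t).
{ clear t; intros t Ht0 Ht2 Hc.
  assert (Hs : 0 <= sin t) by (apply sin_ge_0; lra).
  rewrite Rabs_pos_eq.
  2:{ rewrite <- atan_0; apply atan_le, Rdiv_le_0_compat; nra. }
  (* Below pi/2, tan t exceeds the quotient by sin t / (cos t (1 + r cos t)) >= 0. From pi/2 on, the
     range of [atan] suffices. *)
  destruct (Rlt_dec t (PI / 2)) as [Ht | Ht].
  - rewrite <- (atan_tan t) at 3 by lra; apply atan_le.
    assert (0 < cos t) by (apply cos_gt_0; lra).
    apply Rminus_le_0; unfold tan.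
    replace (sin t / cos t - r * sin t / (1 + r * cos t))
      with (sin t / (cos t * (1 + r * cos t))) by (field; lra).
    apply Rdiv_le_0_compat; nra.
  - pose proof (atan_bound (r * sin t / (1 + r * cos t))); lra. }
intros Ht Hc; destruct (Rle_dec 0 t) as [H0 | H0].
- rewrite (Rabs_pos_eq t H0) in *; now apply Hpos.
- rewrite (Rabs_left t) in * by lra.
  specialize (Hpos (- t)); rewrite sin_neg, cos_neg in Hpos.
  replace (r * - sin t / (1 + r * cos t))
    with (- (r * sin t / (1 + r * cos t))) in Hpos by (field; lra).
  rewrite atan_opp, Rabs_Ropp in Hpos; apply Hpos; lra.
Qed.

Lemma ln_atan_disk (x y : R) : x * x + y * y < 1 ->
  let p := (1 + exp (2 * x) * cos (2 * y)) / 2 in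
  let q := exp (2 * x) * sin (2 * y) / 2 in
  (ln (p * p + q * q) / 2) ^ 2 + atan (q * / p) ^ 2 < 4.
Proof.
intros Hxy p q.
pose proof (cos_gt_disk (- x) y ltac:(lra)) as Hc.
replace (2 * - x) with (- (2 * x)) in Hc by ring; rewrite exp_Ropp in Hc.
pose proof PI2_3_2 as Hpi; pose proof PI2_lt as Hpi'.
assert (Hay : Rabs y * Rabs y = y * y)
  by (rewrite <- Rabs_mult; apply Rabs_pos_eq; nra).
pose proof (Rabs_pos y).
assert (Hay1 : Rabs y < 1) by nra.
assert (Hy2 : Rabs (2 * y) = 2 * Rabs y)
  by (rewrite Rabs_mult, (Rabs_pos_eq 2); lra).
set (r := exp (2 * x)) in *; set (c := cos (2 * y)) in *; set (s := sin (2 * y)) in *.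
assert (Hr : 0 < r) by apply exp_pos.
assert (Hp : 0 < 1 + r * c).
{ apply Rmult_lt_compat_l with (1 := Hr) in Hc.
  replace (r * - / r) with (- 1) in Hc by (field; lra); lra. }
assert (HA : Rabs (atan (q * / p)) <= 2 * Rabs y).
{ replace (q * / p) with (r * s / (1 + r * c)) by (unfold p, q; field; lra).
  rewrite <- Hy2; apply Rabs_atan_arg_le; trivial; lra. }
set (A := atan (q * / p)) in *.
assert (HA2 : A ^ 2 <= 4 * (y * y)).
{ rewrite <- pow2_abs; pose proof (Rabs_pos A); nra. }
assert (Hsc : s * s + c * c = 1) by apply sin2_cos2.
assert (HN : p * p + q * q = (1 + 2 * r * c + r * r) / 4).
{ unfold p, q; replace (r * r) with (r * r * (s * s + c * c)) by (rewrite Hsc; ring).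
  field. }
(* Here 4 N = (r + c)^2 + 1 - c^2. If c < 0, then -c < 2|y| - 3/2 < 1/2, so 4 N > 3/4; if c >= 0,
   then 4 N >= 1. *)
assert (HN1 : 3 / 16 <= p * p + q * q).
{ rewrite HN; destruct (Rle_dec 0 c) as [H0 | H0]; [nra |].
  pose proof (neg_cos_lt (Rabs (2 * y)) (Rabs_pos _)) as H1.
  rewrite cos_Rabs, Hy2 in H1; fold c in H1.
  pose proof (Rle_0_sqr (r + c)); unfold Rsqr in *; nra. }
set (N := p * p + q * q) in *.
destruct (Rle_dec (ln N) 0) as [HL | HL].
(* Now (ln N)/2 lies in [-1, 0] and |A| < 17/10, so the sum is at most 1 + 2.89. *)
- assert (- 2 <= ln N).
  { rewrite <- (ln_exp (- 2)); pose proof exp_opp_2_lt.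
    apply ln_le; [apply exp_pos | lra]. }
  pose proof (atan_bound (q * / p)) as HB; fold A in HB.
  nra.
(* Since c <= 1, N <= ((1 + r)/2)^2 <= max(1, r)^2. Hence 0 < (ln N)/2 <= 2|x|, and with |A| <= 2|y|
   the sum is at most 4(x^2 + y^2). *)
- assert (Hln : ln N <= 4 * Rabs x).
  { rewrite <- (ln_exp (4 * Rabs x)); apply ln_le; [lra |].
    assert (Hc1 : c <= 1) by apply COS_bound.
    apply Rle_trans with (Rmax 1 r * Rmax 1 r).
    - rewrite HN; pose proof (Rmax_l 1 r); pose proof (Rmax_r 1 r); nra.
    - replace (4 * Rabs x) with (2 * Rabs x + 2 * Rabs x) by ring; rewrite exp_plus.
      pose proof (Rmax_l 1 r).
      assert (Rmax 1 r <= exp (2 * Rabs x)).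
      { apply Rmax_lub.
        - rewrite <- exp_0; apply exp_le; pose proof (Rabs_pos x); lra.
        - apply exp_le; pose proof (Rle_abs x); lra. }
      nra. }
  assert (Rabs x * Rabs x = x * x)
    by (rewrite <- Rabs_mult; apply Rabs_pos_eq; nra).
  nra.
Qed.

(** * The logarithm of [frakB] *)

Definition logB_arg (z : C) : C := (/ 2 * (1 + Cexp (- 2 * z)))%C.

Definition logB (z : C) : C := (- / 2 * Clog (logB_arg z))%C.

(** The signs are kept inside so that [ln_atan_disk] applies at -z. *)
Lemma logB_arg_pair (z : C) :
  logB_arg z = ((1 + exp (2 * - Re z) * cos (2 * - Im z)) / 2,
                exp (2 * - Re z) * sin (2 * - Im z) / 2).
Proof.
unfold logB_arg, Cexp; destruct z as [x y]; simpl.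
replace (-2 * x - 0 * y) with (2 * - x) by ring.
replace (-2 * y + 0 * x) with (2 * - y) by ring.
unfold Cinv, Cmult, Cplus, RtoC; simpl; f_equal; field.
Qed.

Lemma logB_pair (z : C) :
  logB z = (- / 2 * Re (Clog (logB_arg z)), - / 2 * Im (Clog (logB_arg z))).
Proof.
unfold logB, Cinv, Cmult, Copp, RtoC, Re, Im; simpl; f_equal; field.
Qed.

Lemma in_disk_sqr (z : C) : in_disk z <-> Re z * Re z + Im z * Im z < 1.
Proof.
unfold in_disk, Cmod, Re, Im; simpl; rewrite !Rmult_1_r; split; intros H.
- apply Rnot_le_lt; intros Hle; apply sqrt_le_1_alt in Hle.
  rewrite sqrt_1 in Hle; lra.
- rewrite <- sqrt_1; apply sqrt_lt_1_alt; split; [nra | exact H].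
Qed.

Lemma logB_arg_pos (z : C) : in_disk z -> 0 < Re (logB_arg z).
Proof.
intros Hz; apply in_disk_sqr in Hz; rewrite logB_arg_pair; simpl.
pose proof (cos_gt_disk (Re z) (- Im z) ltac:(lra)) as Hc.
replace (2 * - Re z) with (- (2 * Re z)) by ring.
rewrite exp_Ropp; pose proof (exp_pos (2 * Re z)) as He.
apply Rmult_lt_compat_l with (1 := Rinv_0_lt_compat _ He) in Hc.
replace (/ exp (2 * Re z) * - exp (2 * Re z)) with (- 1) in Hc by (field; lra).
lra.
Qed.

Lemma logB_in_disk (z : C) : in_disk z -> in_disk (logB z).
Proof.
intros Hz; apply in_disk_sqr in Hz; apply in_disk_sqr; rewrite logB_pair.
pose proof (ln_atan_disk (- Re z) (- Im z) ltac:(lra)) as H.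
unfold Clog; rewrite logB_arg_pair.
cbn [Re Im fst snd] in *.
(* The factor 1/2 in [logB] shrinks the disk of radius 2 to the unit disk. *)
assert (K : forall a b : R, a ^ 2 + b ^ 2 < 4 ->
          - / 2 * a * (- / 2 * a) + - / 2 * b * (- / 2 * b) < 1).
{ intros a b Hab; replace (_ + _) with ((a ^ 2 + b ^ 2) / 4) by field; lra. }
apply K, H.
Qed.

Lemma logB_0 : logB 0 = 0%C.
Proof.
assert (H : logB_arg 0 = 1%C)
  by (unfold logB_arg; rewrite Cmult_0_r, Cexp_0;
      unfold Cinv, Cmult, Cplus, RtoC; simpl; f_equal; field).
rewrite logB_pair, H; unfold Clog, RtoC; simpl.
replace (1 * 1 + 0 * 0) with 1 by ring; replace (0 * / 1) with 0 by field.
rewrite ln_1, atan_0; f_equal; field.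
Qed.

(** The imaginary part of [logB z] is half an arctangent, hence within pi/4 of 0, so the exponential
    has positive real part. Its square is 1 / [logB_arg z] = 1 + tanh z, and [Csqrt_unique]
    concludes. *)
Lemma Cexp_logB (z : C) : in_disk z -> Cexp (logB z) = frakB z.
Proof.
intros Hz; pose proof (logB_arg_pos z Hz) as Hp.
apply Csqrt_unique.
- rewrite logB_pair; unfold Cexp, Clog; set (w := logB_arg z); cbn [Re Im fst snd].
  apply Rmult_lt_0_compat; [apply exp_pos |].
  pose proof (atan_bound (Im w * / Re w)).
  apply cos_gt_0; lra.
- assert (Hd : (1 + Cexp (- 2 * z))%C <> 0%C).
  { intros H0; unfold logB_arg in Hp; rewrite H0, Cmult_0_r in Hp; simpl in Hp; lra. }
  rewrite <- Cexp_plus.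
  replace (logB z + logB z)%C with (- Clog (logB_arg z))%C
    by (unfold logB; field; apply RtoC_neq; lra).
  rewrite Cexp_opp, Cexp_Clog by exact Hp.
  assert (He : Cexp (- 2 * z) = (/ Cexp z * / Cexp z)%C)
    by (rewrite <- Cexp_opp, <- Cexp_plus; f_equal; ring).
  unfold logB_arg, Ctanh; rewrite He in *; rewrite Cexp_opp.
  pose proof (Cexp_neq_0 z) as Hz0; set (e := Cexp z) in *.
  (* This is the denominator of tanh up to the factor e; it vanishes only if 1 + e^(-2z) does. *)
  assert (Hd' : (e * e + 1)%C <> 0%C).
  { intros H0; apply Hd.
    transitivity ((e * e + 1) * (/ e * / e))%C; [now field | rewrite H0; ring]. }
  field; now split.
Qed.

Lemma ex_derive_logB (z : C) : in_disk z ->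
  @ex_derive C_AbsRing C_NormedModule logB z.
Proof.
intros Hz.
(* Adding 0 gives the linear map the shape expected by [ex_derive_C_affine]. *)
apply (ex_derive_ext (K := C_AbsRing) (V := C_NormedModule)
  (fun t => - / 2 * Clog (logB_arg t) + 0)%C); [intros t; apply Cplus_0_r |].
apply (ex_derive_C_comp (fun u => - / 2 * u + 0)%C); [apply ex_derive_C_affine |].
apply (ex_derive_C_comp Clog).
{ eexists; now apply is_derive_Clog, logB_arg_pos. }
apply (ex_derive_ext (K := C_AbsRing) (V := C_NormedModule)
  (fun t => / 2 * Cexp (- 2 * t + 0) + / 2)%C).
{ intros t; unfold logB_arg; rewrite Cplus_0_r.
  change (/ 2 * Cexp (-2 * t) + / 2 = / 2 * (1 + Cexp (-2 * t)))%C; ring. }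
apply (ex_derive_C_comp (fun u => / 2 * u + / 2)%C); [apply ex_derive_C_affine |].
apply (ex_derive_C_comp Cexp); [eexists; apply is_derive_Cexp |].
apply ex_derive_C_affine.
Qed.

Theorem theorem2p12 (f : C -> C) (hf : S_star_B f) : S_star_e f.
Proof.
destruct hf as [[hA _] (w & Hw & Hdisk & Hw0 & Heq)].
split; [exact hA |].
exists (fun z => logB (w z)); repeat split.
- intros z Hz.
  apply (ex_derive_C_comp logB w); [now apply ex_derive_logB, Hdisk | now apply Hw].
- intros z Hz; now apply logB_in_disk, Hdisk.
- now rewrite Hw0, logB_0.
- intros z Hz; rewrite Cexp_logB by now apply Hdisk.
  now apply Heq.
Qed.
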